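(* Let $f:\mathbb{R}^n\to\mathbb{R}$ be continuously differentiable, $m_f$-strongly convex with $m_f>0$, and with $L_f$-Lipschitz continuous gradient. Let $g:\mathbb{R}^n\to\mathbb{R}\cup\{+\infty\}$ be proper, lower semi-continuous and convex. Let $C\in\mathbb{R}^{m\times n}$ have full row rank, $\mathrm{rank}(C)=m$, and let $d\in\mathbb{R}^m$. Let $K,L\in\mathbb{R}^{m\times m}$ be such that the matrix $$N=\begin{bmatrix}0 & I\\ L & K\end{bmatrix}\in\mathbb{R}^{2m\times 2m}$$ satisfies $NQN^\top-(1-r_e)Q\prec 0$ for some symmetric $Q=Q^\top\succ 0$ and some $r_e\in(0,1)$. Then, for all $\mu\in\left(0,\frac{2}{L_f}\right)$, the discrete-time dynamical system on $\mathbb{R}^n\times\mathbb{R}^m$ $$\begin{aligned}x^+&=\Pi(x)-C^\top(CC^\top)^{-1}\big(C\,\Pi(x)+d-v\big),\\ v^+&=Kv+L(Cx+d),\end{aligned}\qquad \Pi(x)=\mathrm{prox}_{\mu g}\big(x-\mu\nabla f(x)\big),$$ admits a unique globally exponentially stable equilibrium point $(x^\star,v^\star)$.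
   Context: The proximal operator is $\mathrm{prox}_{\mu g}(v)=\arg\min_{x\in\mathbb{R}^n}\big(g(x)+\frac{1}{2\mu}\|x-v\|_2^2\big)$, which is single-valued when $g$ is proper, lower semi-continuous and convex. The superscript $+$ denotes the forward time shift (next value of the signal). An equilibrium point is a fixed point of the update map. It is globally exponentially stable if there exist $\kappa>0$ and $r\in(0,1)$ such that for every initial condition $(x_0,v_0)$ the trajectory satisfies $\|(x_k,v_k)-(x^\star,v^\star)\|_2\le\kappa\, r^k\,\|(x_0,v_0)-(x^\star,v^\star)\|_2$ for all $k\in\mathbb{N}$. *)

(* Defs.v *)
From mathcomp Require Import all_boot all_order all_algebra.
From mathcomp Require Import all_classical all_reals all_analysis.

Set Implicit Arguments.
Unset Strict Implicit.
Unset Printing Implicit Defensive.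

Import Order.TTheory GRing.Theory Num.Theory.
Import numFieldNormedType.Exports.

Local Open Scope classical_set_scope.
Local Open Scope ring_scope.

Section Defs.
Context {R : realType}.

(* The library norm `|x| on matrices is the sup norm, so the Euclidean norm is
   defined here; both induce the topology used by [differentiable],
   [continuous] and [lower_semicontinuous]. *)
Definition enorm k (x : 'cV[R]_k) : R := Num.sqrt (\sum_i x i 0 ^+ 2).

Definition grad n (f : 'cV[R]_n -> R) (x : 'cV[R]_n) : 'cV[R]_n :=
  \col_i 'd f x (delta_mx i 0).

Definition continuously_differentiable n (f : 'cV[R]_n -> R) : Prop :=
  (forall x, differentiable f x) /\ continuous (grad f).

Definition strongly_convex n (mf : R) (f : 'cV[R]_n -> R) : Prop :=
  forall (x y : 'cV[R]_n) (t : R), 0 <= t <= 1 ->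
    f (t *: x + (1 - t) *: y) <=
      t * f x + (1 - t) * f y - mf / 2 * t * (1 - t) * enorm (x - y) ^+ 2.

(* [lipschitz] from the library would use the sup norm. *)
Definition elipschitz n p (L : R) (F : 'cV[R]_n -> 'cV[R]_p) : Prop :=
  forall x y, enorm (F x - F y) <= L * enorm (x - y).

(* Properness of an extended-valued function; the first conjunct says that its
   values lie in R `|` {+oo}. *)
Definition proper_fun n (g : 'cV[R]_n -> \bar R) : Prop :=
  (forall x, g x != -oo%E) /\ (exists x, (g x < +oo)%E).

(* At t = 0 and t = 1 the library convention 0 * +oo = 0 makes the inequality
   trivially true, as usual. *)
Definition econvex n (g : 'cV[R]_n -> \bar R) : Prop :=
  forall (x y : 'cV[R]_n) (t : R), 0 <= t <= 1 ->
    (g (t *: x + (1 - t)%R *: y)%R <= t%:E * g x + (1 - t)%:E * g y)%E.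

Definition prox_argmin n (mu : R) (g : 'cV[R]_n -> \bar R) (v : 'cV[R]_n)
    : set 'cV[R]_n :=
  [set x | forall y, (g x + ((2 * mu)^-1 * enorm (x - v) ^+ 2)%:E
                   <= g y + ((2 * mu)^-1 * enorm (y - v) ^+ 2)%:E)%E].

(* The junk value 0 is returned only when there is no minimizer, which does not
   happen for mu > 0 and g proper, lower semi-continuous and convex. *)
Definition prox n (mu : R) (g : 'cV[R]_n -> \bar R) (v : 'cV[R]_n) : 'cV[R]_n :=
  xget 0 (prox_argmin mu g v).

Definition prox_grad n (mu : R) (f : 'cV[R]_n -> R) (g : 'cV[R]_n -> \bar R)
    (x : 'cV[R]_n) : 'cV[R]_n :=
  prox mu g (x - mu *: grad f x).

Definition posdefmx k (Q : 'M[R]_k) : Prop :=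
  Q^T = Q /\ forall x : 'cV[R]_k, x != 0 -> 0 < (x^T *m Q *m x) 0 0.

Definition negdefmx k (Q : 'M[R]_k) : Prop := posdefmx (- Q).

Definition update n m (mu : R) (f : 'cV[R]_n -> R) (g : 'cV[R]_n -> \bar R)
    (C : 'M[R]_(m, n)) (d : 'cV[R]_m) (K L : 'M[R]_m)
    (z : 'cV[R]_n * 'cV[R]_m) : 'cV[R]_n * 'cV[R]_m :=
  let: (x, v) := z in
  (prox_grad mu f g x -
     C^T *m invmx (C *m C^T) *m (C *m prox_grad mu f g x + d - v),
   K *m v + L *m (C *m x + d)).

Definition equilibrium (T : Type) (F : T -> T) (z : T) : Prop := F z = z.

(* Euclidean norm on the product, not the sup norm of the library. *)
Definition pnorm n m (z : 'cV[R]_n * 'cV[R]_m) : R := enorm (col_mx z.1 z.2).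

Definition globally_exp_stable n m
    (F : 'cV[R]_n * 'cV[R]_m -> 'cV[R]_n * 'cV[R]_m)
    (zs : 'cV[R]_n * 'cV[R]_m) : Prop :=
  exists kappa r : R, [/\ 0 < kappa, 0 < r < 1 &
    forall z0 (k : nat),
      pnorm (iter k F z0 - zs) <= kappa * r ^+ k * pnorm (z0 - zs)].

End Defs.

(* Main.v *)
Require Import Defs.
From mathcomp Require Import all_boot all_order all_algebra.
From mathcomp Require Import all_classical all_reals all_analysis.
From mathcomp Require Import ring lra.

Set Implicit Arguments.
Unset Strict Implicit.
Unset Printing Implicit Defensive.

Import Order.TTheory GRing.Theory Num.Theory.
Import numFieldNormedType.Exports.

Local Open Scope classical_set_scope.
Local Open Scope ring_scope.

(** The update is a contraction for a norm on the product space, so Banach's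
    theorem yields the equilibrium, its uniqueness and the exponential rate at
    once. The norm comes from the triangular structure of the dynamics.

    Write [w = C x + d] for the constraint residual and [Cpinv] for the right
    inverse [C^T (C C^T)^-1] of [C]. The first component of the update is
    [(I - Cpinv C) Pi(x) + Cpinv (v - d)], so its image under [C] is [v - d]:
    the new residual is exactly [v], and [(w, v)] evolves by the linear map
    [N], whatever [f] and [g] are. The Lyapunov inequality says that [N^T]
    contracts the norm of [Q]; by duality [N] contracts the norm of [Q^-1]
    ([lyapunov_contraction]).

    In the first component, differences [x - x'] are mapped to
    [(I - Cpinv C) (Pi(x) - Pi(x')) + Cpinv (v - v')]. The matrix
    [I - Cpinv C] is the orthogonal projection on the kernel of [C], hence
    nonexpansive ([kernel_projection_nonexpansive]), and [Pi] is a contraction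
    ([prox_grad_contraction]): the gradient step contracts because the gradient
    is cocoercive (from the descent lemma) and strongly monotone, and the
    proximal map is nonexpansive. Thus [x] contracts up to an input from [v],
    and [W (x, v) = |x| + beta |(C x, v)|_(Q^-1)] contracts as soon as [beta]
    is large enough to absorb that input.

    That the proximal map attains its minimum is shown without compactness.
    Lower semicontinuity at one point bounds [g] below near that point,
    convexity spreads this to a minorant that decreases linearly in the
    distance, so the proximal objective is bounded below; as it is strongly
    convex, its near-minimizers cluster, and completeness gives a limit
    ([approx_limit]). *)

(** * Norms of positive definite matrices *)

Section QuadraticNorms.
Context {R : realType}.
Implicit Types k : nat.

Definition qdot k (S : 'M[R]_k) (x y : 'cV[R]_k) : R := (x^T *m S *m y) 0 0.

Definition qnorm k (S : 'M[R]_k) (x : 'cV[R]_k) : R := Num.sqrt (qdot S x x).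

Lemma qdotDl k (S : 'M[R]_k) x y z : qdot S (x + y) z = qdot S x z + qdot S y z.
Proof. by rewrite /qdot linearD/= !mulmxDl mxE. Qed.

Lemma qdotDr k (S : 'M[R]_k) x y z : qdot S z (x + y) = qdot S z x + qdot S z y.
Proof. by rewrite /qdot mulmxDr mxE. Qed.

Lemma qdotZl k (S : 'M[R]_k) a x y : qdot S (a *: x) y = a * qdot S x y.
Proof. by rewrite /qdot linearZ/= -!scalemxAl mxE. Qed.

Lemma qdotZr k (S : 'M[R]_k) a x y : qdot S x (a *: y) = a * qdot S x y.
Proof. by rewrite /qdot -!scalemxAr mxE. Qed.

Lemma qdotNl k (S : 'M[R]_k) x y : qdot S (- x) y = - qdot S x y.
Proof. by rewrite -scaleN1r qdotZl mulN1r. Qed.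

Lemma qdotNr k (S : 'M[R]_k) x y : qdot S x (- y) = - qdot S x y.
Proof. by rewrite -scaleN1r qdotZr mulN1r. Qed.

Lemma qdot0l k (S : 'M[R]_k) x : qdot S 0 x = 0.
Proof. by rewrite /qdot trmx0 !mul0mx mxE. Qed.

Lemma qdotC k (S : 'M[R]_k) x y : S^T = S -> qdot S x y = qdot S y x.
Proof.
move=> Ssym; rewrite /qdot -[x^T *m S *m y]trmxK [in LHS]mxE.
by rewrite !trmx_mul trmxK Ssym mulmxA.
Qed.

Definition qdot_bilin := (qdotDl, qdotDr, qdotNl, qdotNr, qdotZl, qdotZr).

Lemma qdot_ge0 k (S : 'M[R]_k) x : posdefmx S -> 0 <= qdot S x x.
Proof.
case=> _ Spos; have [->|x0] := eqVneq x 0; first by rewrite qdot0l.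
exact/ltW/Spos.
Qed.

Lemma qnorm_ge0 k (S : 'M[R]_k) x : 0 <= qnorm S x.
Proof. exact: sqrtr_ge0. Qed.

Lemma sqr_qnorm k (S : 'M[R]_k) x : posdefmx S -> qnorm S x ^+ 2 = qdot S x x.
Proof. by move=> Spos; rewrite sqr_sqrtr// qdot_ge0. Qed.

(** Cauchy-Schwarz, from positivity of [S] at [c x - b y], where
    [c = <y, y>] and [b = <x, y>]. *)
Lemma qdot_cauchy_schwarz k (S : 'M[R]_k) x y : posdefmx S ->
  qdot S x y <= qnorm S x * qnorm S y.
Proof.
move=> Spos; have [Ssym Sgt0] := Spos.
apply: le_trans (ler_norm _) _; rewrite -ler_sqr ?nnegrE ?mulr_ge0 ?qnorm_ge0//.
rewrite real_normK ?num_real// exprMn !sqr_qnorm//.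
have [->|y0] := eqVneq y 0; first by rewrite [qdot S x 0]qdotC// !qdot0l expr0n mulr0.
have c0 : 0 < qdot S y y by exact: Sgt0.
have := qdot_ge0 (qdot S y y *: x - qdot S x y *: y) Spos.
rewrite !qdot_bilin (qdotC y x Ssym).
set a := qdot S x x; set b := qdot S x y; set c := qdot S y y => h.
rewrite -subr_ge0 -(pmulr_rge0 _ c0); apply: le_trans h _; rewrite -/c; lra.
Qed.

Lemma ler_qnormD k (S : 'M[R]_k) x y : posdefmx S ->
  qnorm S (x + y) <= qnorm S x + qnorm S y.
Proof.
move=> Spos; have [Ssym _] := Spos.
rewrite -ler_sqr ?nnegrE ?addr_ge0 ?qnorm_ge0// sqrrD !sqr_qnorm//.
by rewrite !qdot_bilin (qdotC y x Ssym); have := qdot_cauchy_schwarz x y Spos; lra.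
Qed.

Lemma qnormZ k (S : 'M[R]_k) a x : qnorm S (a *: x) = `|a| * qnorm S x.
Proof.
by rewrite /qnorm !qdot_bilin mulrA -expr2 sqrtrM ?sqr_ge0// sqrtr_sqr.
Qed.

Lemma qnormN k (S : 'M[R]_k) x : qnorm S (- x) = qnorm S x.
Proof. by rewrite -scaleN1r qnormZ normrN1 mul1r. Qed.

Lemma qnorm0 k (S : 'M[R]_k) : qnorm S 0 = 0.
Proof. by rewrite /qnorm qdot0l sqrtr0. Qed.

Lemma qdot1E k (x y : 'cV[R]_k) : qdot 1%:M x y = (x^T *m y) 0 0.
Proof. by rewrite /qdot mulmx1. Qed.

Lemma enormE k (x : 'cV[R]_k) : enorm x = qnorm 1%:M x.
Proof.
rewrite /enorm /qnorm qdot1E mxE; congr Num.sqrt.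
by apply: eq_bigr => i _; rewrite mxE expr2.
Qed.

Lemma posdefmx1 k : posdefmx (1%:M : 'M[R]_k).
Proof.
split=> [|x x0]; first exact: trmx1.
have sumE : (x^T *m 1%:M *m x) 0 0 = \sum_i x i 0 ^+ 2.
  by rewrite mulmx1 mxE; apply: eq_bigr => i _; rewrite mxE expr2.
rewrite sumE lt_neqAle sumr_ge0 ?andbT => [|i _]; last exact: sqr_ge0.
rewrite eq_sym; apply: contra_neq x0 => /eqP.
rewrite psumr_eq0 => [/allP h|i _]; last exact: sqr_ge0.
apply/colP => i; rewrite mxE; apply/eqP; rewrite -sqrf_eq0.
by apply: h; rewrite mem_index_enum.
Qed.

Lemma enorm_ge0 k (x : 'cV[R]_k) : 0 <= enorm x.
Proof. exact: sqrtr_ge0. Qed.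

Lemma enormN k (x : 'cV[R]_k) : enorm (- x) = enorm x.
Proof. by rewrite !enormE qnormN. Qed.

Lemma enormZ k a (x : 'cV[R]_k) : enorm (a *: x) = `|a| * enorm x.
Proof. by rewrite !enormE qnormZ. Qed.

Lemma ler_enormD k (x y : 'cV[R]_k) : enorm (x + y) <= enorm x + enorm y.
Proof. by rewrite !enormE; exact/ler_qnormD/posdefmx1. Qed.

Lemma sqr_enorm k (x : 'cV[R]_k) : enorm x ^+ 2 = qdot 1%:M x x.
Proof. by rewrite enormE sqr_qnorm//; exact: posdefmx1. Qed.

Lemma enorm_eq0 k (x : 'cV[R]_k) : enorm x = 0 -> x = 0.
Proof.
move=> x0; apply/eqP/negPn/negP => /((posdefmx1 k).2 x).
by rewrite -/(qdot 1%:M x x) -sqr_enorm x0 expr0n ltxx.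
Qed.

Lemma dotC k (x y : 'cV[R]_k) : qdot 1%:M x y = qdot 1%:M y x.
Proof. by rewrite qdotC// trmx1. Qed.

Lemma dot_mull k l (A : 'M[R]_(k, l)) x y :
  qdot 1%:M (A *m x) y = qdot 1%:M x (A^T *m y).
Proof. by rewrite !qdot1E trmx_mul mulmxA. Qed.

Lemma dot_mulr k l (A : 'M[R]_(k, l)) x y :
  qdot 1%:M x (A *m y) = qdot 1%:M (A^T *m x) y.
Proof. by rewrite dot_mull trmxK. Qed.

Lemma norm_coord_le k (x : 'cV[R]_k) i : `|x i 0| <= enorm x.
Proof.
rewrite -ler_sqr ?nnegrE ?enorm_ge0// real_normK ?num_real// sqr_sqrtr.
  by rewrite (bigD1 i)//= lerDl sumr_ge0// => j _; exact: sqr_ge0.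
by rewrite sumr_ge0// => j _; exact: sqr_ge0.
Qed.

Lemma enorm_sum k (I : finType) (F : I -> 'cV[R]_k) :
  enorm (\sum_i F i) <= \sum_i enorm (F i).
Proof.
apply: (big_ind2 (fun x (a : R) => enorm x <= a)) => //.
  by rewrite enormE qnorm0.
by move=> x a y b xa yb; exact: le_trans (ler_enormD _ _) (lerD xa yb).
Qed.

Lemma mulmx_bounded k l (A : 'M[R]_(l, k)) :
  exists2 c : R, 0 < c & forall x, enorm (A *m x) <= c * enorm x.
Proof.
exists (1 + \sum_j enorm (col j A)) => [|x].
  by rewrite ltr_pwDl// sumr_ge0// => j _; exact: enorm_ge0.
have -> : A *m x = \sum_j x j 0 *: col j A.
  apply/colP => i; rewrite mxE summxE.
  by apply: eq_bigr => j _; rewrite !mxE mulrC.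
apply: le_trans (enorm_sum _) _.
rewrite mulrDl mul1r mulr_suml ler_wpDl ?enorm_ge0//.
apply: ler_sum => j _; rewrite enormZ mulrC ler_wpM2l ?enorm_ge0//.
exact: norm_coord_le.
Qed.

Lemma qnorm_bounded k (S : 'M[R]_k) : posdefmx S ->
  exists2 c : R, 0 < c & forall x, qnorm S x <= c * enorm x.
Proof.
move=> Spos; have [c c0 Sc] := mulmx_bounded S.
exists (Num.sqrt c) => [|x]; first by rewrite sqrtr_gt0.
rewrite -ler_sqr ?nnegrE ?mulr_ge0 ?sqrtr_ge0// sqr_qnorm//.
rewrite exprMn sqr_sqrtr ?(ltW c0)//.
have -> : qdot S x x = qdot 1%:M x (S *m x) by rewrite qdot1E /qdot mulmxA.
apply: le_trans (qdot_cauchy_schwarz _ _ (posdefmx1 k)) _; rewrite -!enormE.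
by rewrite expr2 mulrCA ler_wpM2l ?enorm_ge0.
Qed.

Lemma posdefmx_unit k (S : 'M[R]_k) : posdefmx S -> S \in unitmx.
Proof.
case=> Ssym Sgt0; rewrite -row_free_unit; apply/inj_row_free => v vS0.
apply/trmx_inj; rewrite trmx0; apply/eqP/negPn/negP => /Sgt0.
by rewrite trmxK vS0 mul0mx mxE ltxx.
Qed.

Lemma qdot_invmx k (Q : 'M[R]_k) x y : posdefmx Q ->
  qdot Q (invmx Q *m x) (invmx Q *m y) = qdot (invmx Q) x y.
Proof.
move=> Qpos; have Qu := posdefmx_unit Qpos.
rewrite /qdot trmx_mul trmx_inv Qpos.1 mulmxA; congr (fun_of_matrix (_ *m _) _ _).
by rewrite mulmxKV.
Qed.

Lemma posdefmx_inv k (Q : 'M[R]_k) : posdefmx Q -> posdefmx (invmx Q).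
Proof.
move=> Qpos; have Qu := posdefmx_unit Qpos.
split=> [|x x0]; first by rewrite trmx_inv Qpos.1.
rewrite -/(qdot _ _ _) -qdot_invmx//; apply: Qpos.2.
apply: contra_neq x0 => h.
by rewrite -(mulKVmx Qu x) h mulmx0.
Qed.

(** No compactness of the sphere is used: writing [x = S^-1 (S x)],
    Cauchy-Schwarz for [S^-1] bounds [|x|^2 = <x, S x>_(S^-1)] by
    [|x|_(S^-1) |x|_S], and the first factor is at most [c |x|]. *)
Lemma qnorm_coercive k (S : 'M[R]_k) : posdefmx S ->
  exists2 c : R, 0 < c & forall x, enorm x <= c * qnorm S x.
Proof.
move=> Spos; have Su := posdefmx_unit Spos; have Qpos := posdefmx_inv Spos.
have [c c0 Qc] := qnorm_bounded Qpos; exists c => // x.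
have [x0|x0] := eqVneq (enorm x) 0.
  by rewrite x0 mulr_ge0 ?qnorm_ge0 ?ltW.
have {}x0 : 0 < enorm x by rewrite lt_neqAle eq_sym x0 enorm_ge0.
rewrite -(ler_pM2l x0) -expr2 sqr_enorm.
have -> : qdot 1%:M x x = qdot (invmx S) x (S *m x).
  by rewrite qdot1E /qdot mulmxA mulmxKV.
apply: le_trans (qdot_cauchy_schwarz _ _ Qpos) _.
have -> : qnorm (invmx S) (S *m x) = qnorm S x.
  by rewrite /qnorm -qdot_invmx// mulKmx.
by rewrite mulrA [enorm x * c]mulrC ler_wpM2r ?qnorm_ge0.
Qed.

(** The hypothesis makes [N^T] a contraction for the norm of [Q], with ratio
    [sqrt (1 - re)]. The norms of [Q] and [Q^-1] are dual, so [N] contracts the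
    latter with the same ratio: with [y = Q^-1 N x], the square of
    [|N x|_(Q^-1)] is [<N^T y, Q^-1 x>_Q], to which Cauchy-Schwarz applies. *)
Lemma lyapunov_contraction k (N Q : 'M[R]_k) (re : R) :
  posdefmx Q -> 0 < re < 1 -> negdefmx (N *m Q *m N^T - (1 - re) *: Q) ->
  exists2 r : R, 0 < r < 1 &
    forall x, qnorm (invmx Q) (N *m x) <= r * qnorm (invmx Q) x.
Proof.
move=> Qpos /andP[re0 re1] Nneg.
have Qu := posdefmx_unit Qpos; have Spos := posdefmx_inv Qpos.
have s0 : 0 < Num.sqrt (1 - re) by rewrite sqrtr_gt0; lra.
exists (Num.sqrt (1 - re)) => [|x].
  by rewrite s0 -[ltRHS]sqrtr1 ltr_sqrt//; lra.
have NT y : qnorm Q (N^T *m y) <= Num.sqrt (1 - re) * qnorm Q y.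
  rewrite -ler_sqr ?nnegrE ?mulr_ge0 ?qnorm_ge0 ?(ltW s0)// exprMn !sqr_qnorm//.
  rewrite sqr_sqrtr; last lra.
  rewrite -subr_ge0; have := qdot_ge0 y Nneg; congr (0 <= _).
  rewrite /qdot trmx_mul trmxK opprB mulmxBr mulmxBl -scalemxAr -scalemxAl.
  by rewrite !mulmxA mxE [X in X + _]mxE [X in _ + X]mxE.
set s := Num.sqrt _ in NT s0 *; set A := qnorm _ _.
pose y := invmx Q *m (N *m x).
have yE : qnorm Q y = A by rewrite /A /qnorm qdot_invmx.
have [A0|A0] := eqVneq A 0; first by rewrite A0 mulr_ge0 ?qnorm_ge0// ltW.
have {}A0 : 0 < A by rewrite lt_neqAle eq_sym A0 qnorm_ge0.
rewrite -(ler_pM2l A0) -expr2 sqr_qnorm//.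
have -> : qdot (invmx Q) (N *m x) (N *m x) = qdot Q (N^T *m y) (invmx Q *m x).
  rewrite /qdot /y !trmx_mul trmxK trmx_inv Qpos.1 !mulmxA.
  by rewrite mulmxK.
apply: le_trans (qdot_cauchy_schwarz _ _ Qpos) _.
have -> : qnorm Q (invmx Q *m x) = qnorm (invmx Q) x.
  by rewrite /qnorm qdot_invmx.
by rewrite mulrCA mulrA -yE ler_wpM2r ?qnorm_ge0.
Qed.

End QuadraticNorms.

(** * Completeness and fixed points *)

Section Completeness.
Context {R : realType}.

Lemma mx_norm_le_enorm k (x : 'cV[R]_k) : `|x| <= enorm x.
Proof.
rewrite [`|x|]mx_normrE; apply: bigmax_le => [|[i j] _ /=]; first exact: enorm_ge0.
by rewrite (ord1 j) norm_coord_le.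
Qed.

Lemma enorm_le_mx_norm k :
  exists2 c : R, 0 < c & forall x : 'cV[R]_k, enorm x <= c * `|x|.
Proof.
exists (1 + \sum_(i < k) enorm (delta_mx i 0 : 'cV[R]_k)) => [|x].
  by rewrite ltr_pwDl// sumr_ge0// => j _; exact: enorm_ge0.
rewrite {1}[x]matrix_sum_delta.
under eq_bigr do rewrite big_ord1.
apply: le_trans (enorm_sum _) _.
rewrite mulrDl mul1r mulr_suml ler_wpDl//.
apply: ler_sum => j _; rewrite enormZ mulrC ler_wpM2l ?enorm_ge0//.
by rewrite [leRHS]mx_normrE; apply: (le_bigmax _ _ (j, 0)).
Qed.

Lemma nbhs_enorm_ball k (x : 'cV[R]_k) (V : set 'cV[R]_k) : nbhs x V ->
  exists2 e : R, 0 < e & forall y, enorm (y - x) < e -> V y.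
Proof.
move=> /nbhs_ballP[e /= e0 xV]; exists e => // y yx; apply: xV.
rewrite -ball_normE /= -normrN opprB.
exact: le_lt_trans (mx_norm_le_enorm _) yx.
Qed.

(** Completeness in the form used both for fixed points and for minimizers:
    if the approximate solutions at precision [e] exist and form a set of
    diameter at most [e], then some point is approached by approximate
    solutions of every precision. *)
Lemma approx_limit k (P : R -> 'cV[R]_k -> Prop) :
  (forall e, 0 < e -> exists x, P e x) ->
  (forall e e' x, 0 < e' -> e' <= e -> P e' x -> P e x) ->
  (forall e x y, 0 < e -> P e x -> P e y -> enorm (x - y) <= e) ->
  exists l, forall e, 0 < e -> exists2 x, P e x & enorm (x - l) <= e.
Proof.
move=> Pex Pmono Pdiam.
have inv0 (j : nat) : 0 < j.+1%:R^-1 :> R by rewrite invr_gt0 ltr0Sn.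
have /choice[u Pu] : forall j : nat, exists x, P j.+1%:R^-1 x.
  by move=> j; exact: Pex.
have small (e : R) : 0 < e -> exists j : nat, j.+1%:R^-1 < e.
  move=> e0; have [j _ je] := near_infty_natSinv_lt (PosNum e0).
  by exists j; exact: (je j (leqnn j)).
have Pu_le e i j : i.+1%:R^-1 <= e -> (i <= j)%N -> P e (u j).
  move=> ie ij; apply: Pmono (inv0 j) _ (Pu j); apply: le_trans ie.
  by rewrite lef_pV2 ?posrE ?ltr0Sn// ler_nat.
have ucauchy : cauchy (u @ \oo).
  apply: cauchy_exP => e e0; have [i ie] := small _ e0.
  exists (u i); exists i => // j /= ij.
  rewrite -ball_normE /=; apply: le_lt_trans ie.
  by apply: le_trans (mx_norm_le_enorm _) _; apply: Pdiam => //; exact: Pu_le.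
have /cvgrPdist_lt ul : u @ \oo --> lim (u @ \oo) by exact: cauchy_cvg.
exists (lim (u @ \oo)) => e e0.
have [c c0 cle] := enorm_le_mx_norm k.
have [i ie] := small _ e0.
have [i' _ i'e] := ul _ (divr_gt0 e0 c0).
exists (u (maxn i i')); first by apply: Pu_le (ltW ie) _; exact: leq_maxl.
rewrite -enormN opprB; apply: le_trans (cle _) _.
rewrite mulrC -ler_pdivlMr//; apply/ltW/i'e; exact: leq_maxr.
Qed.

(** Banach's theorem for a norm [W] equivalent to the Euclidean one. A point
    is an approximate solution when [W (x - F x)] is small; such points are
    close to each other since
    [(1 - r) W (x - y) <= W (x - F x) + W (y - F y)], and iterates of [F]
    provide them. *)
Lemma banach_fixed_point k (W : 'cV[R]_k -> R) (F : 'cV[R]_k -> 'cV[R]_k)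
    (a b r : R) :
  0 < a -> 0 < b -> 0 < r < 1 ->
  (forall x y, W (x + y) <= W x + W y) -> (forall x, W (- x) = W x) ->
  (forall x, enorm x <= a * W x) -> (forall x, W x <= b * enorm x) ->
  (forall x y, W (F x - F y) <= r * W (x - y)) ->
  exists l, F l = l.
Proof.
move=> a0 b0 /andP[r0 r1] WD WN aW Wb FW.
have Wtri x y z : W (x - z) <= W (x - y) + W (y - z).
  by apply: le_trans (WD _ _); rewrite addrA subrK.
have Wsym x y : W (x - y) = W (y - x) by rewrite -WN opprB.
have W0 x : 0 <= W x by rewrite -(pmulr_rge0 _ a0) (le_trans (enorm_ge0 x)).
have s0 : 0 < 1 - r by rewrite subr_gt0.
pose P (e : R) x := 2 * a * W (x - F x) <= (1 - r) * e.
have [|||l Pl] := @approx_limit k P.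
- move=> e e0; set D := W (0 - F 0).
  have Witer j : W (iter j F 0 - F (iter j F 0)) <= D * r ^+ j.
    elim: j => [|j IH]; first by rewrite expr0 mulr1.
    apply: le_trans (FW _ _) _.
    by rewrite exprSr mulrA [leRHS]mulrC ler_wpM2l// ltW.
  have /cvgrPdist_lt rj : (fun j => 2 * a * D * r ^+ j) @ \oo --> (0 : R).
    by apply: cvg_geometric; rewrite ger0_norm ?ltW.
  have [j _ /(_ j (leqnn j))] := rj _ (mulr_gt0 s0 e0).
  rewrite sub0r normrN => /(le_lt_trans (ler_norm _)) je.
  exists (iter j F 0); apply: le_trans (ltW je).
  by rewrite -!mulrA ler_pM2l// ler_pM2l.
- move=> e e' x _ ee'; rewrite /P => /le_trans; apply.
  by rewrite ler_pM2l.
- move=> e x y e0; rewrite /P => Px Py.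
  have h : (1 - r) * W (x - y) <= W (x - F x) + W (y - F y).
    have := Wtri x (F x) y; have := Wtri (F x) (F y) y; have := FW x y.
    by rewrite [W (F y - y)]Wsym; lra.
  apply: le_trans (aW _) _; rewrite -(ler_pM2l s0).
  have := ler_wpM2l (ltW a0) h; lra.
exists l; apply/eqP; rewrite -subr_eq0 -oppr_eq0 opprB.
apply/eqP/enorm_eq0/le_anti; rewrite enorm_ge0 andbT.
apply: le_trans (aW _) _; apply/ler_addgt0Pr => e e0; rewrite add0r.
have c0 : 0 < 2 * (a * b) + 1 by rewrite addr_gt0// mulr_gt0// mulr_gt0.
(* The final estimate is [a W (l - F l) <= (2 a b + 1) d], which fixes [d]. *)
pose d := e / (2 * (a * b) + 1); have d0 : 0 < d by exact: divr_gt0.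
have [x] := Pl d d0; rewrite /P => Px xl.
have := Wtri l x (F l); have := Wtri x (F x) (F l); have := FW x l.
rewrite [W (l - x)]Wsym.
have := Wb (x - l); have := ler_wpM2l (ltW b0) xl.
have ed : e = (2 * (a * b) + 1) * d by rewrite /d mulrC divfK// gt_eqF.
have := W0 (x - l); have := W0 (x - F x).
set w1 := W (x - F x) in Px *; set w := W (x - l).
move=> w10 w0 h1 h2 h3 h4 h5.
have rw : r * w <= w by rewrite ler_piMl// ltW.
have aw1 : 2 * (a * w1) <= d by apply: le_trans (_ : (1 - r) * d <= _); nra.
have awl : a * w <= a * (b * d) by rewrite ler_pM2l// (le_trans h2).
have : a * W (l - F l) <= a * (2 * w + w1) by rewrite ler_pM2l//; lra.
by lra.
Qed.

End Completeness.

(** * The gradient step of a smooth strongly convex function *)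

Section SmoothStronglyConvex.
Context {R : realType} {n : nat}.
Implicit Types (f : 'cV[R]_n -> R) (x y h : 'cV[R]_n).

Lemma diff_grad f x h : differentiable f x -> 'd f x h = qdot 1%:M (grad f x) h.
Proof.
move=> df; rewrite {1}[h]matrix_sum_delta qdot1E mxE linear_sum.
by apply: eq_bigr => i _; rewrite big_ord1 linearZ/= !mxE mulrC.
Qed.

Lemma derive_grad f x h : differentiable f x ->
  is_derive x h f (qdot 1%:M (grad f x) h).
Proof.
move=> df; rewrite -diff_grad// -deriveE//.
exact/derivableP/diff_derivable.
Qed.

(** Translating the line to [t] identifies its difference quotients with
    those of the directional derivative. *)
Lemma derive_line f x h (t : R) : differentiable f (t *: h + x) ->
  is_derive t 1 (fun s : R => f (s *: h + x)) (qdot 1%:M (grad f (t *: h + x)) h).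
Proof.
move=> /(derive_grad h)[]; rewrite /derivable /derive.
have -> : (fun s : R => s^-1 *: ((f \o shift (t *: h + x)) (s *: h) - f (t *: h + x)))
  = (fun s : R => s^-1 *: (((fun u : R => f (u *: h + x)) \o shift t) (s *: 1)
      - f (t *: h + x))).
  by apply/funext => s /=; rewrite [s *: 1]mulr1 scalerDl addrA.
by move=> ? ?; split.
Qed.

(** The convexity inequality at [t y + (1 - t) x] bounds a difference quotient
    by [f y - f x] up to a quadratic term, and [t] tends to 0. *)
Lemma strongly_convex_grad mf f x y : differentiable f x ->
  strongly_convex mf f ->
  f x + qdot 1%:M (grad f x) (y - x) + mf / 2 * enorm (y - x) ^+ 2 <= f y.
Proof.
move=> df fconv; set h := y - x; set H := enorm h ^+ 2.
have [/cvg_ex[/= D Dcvg]] := derive_grad h df.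
rewrite /derive => Dlim; have DE := cvg_lim (@norm_hausdorff _ _) Dcvg.
rewrite DE in Dlim; rewrite -Dlim {DE Dlim}.
apply/ler_addgt0Pr => e e0.
pose c := 1 + `|mf / 2 * H|; have c0 : 0 < c by rewrite ltr_pwDl.
have [d /= d0 dD] :=
  (@cvgrPdist_lt _ _ _ _ _ _ _).1 Dcvg (e / 2) (divr_gt0 e0 (ltr0Sn _ _)).
(* The three bounds on [t] put it in the range of the limit, below 1, and
   make the quadratic correction at most [e / 2]. *)
pose t := Num.min (d / 2) (Num.min (1 / 2) (e / (2 * c))).
have t0 : 0 < t by rewrite !lt_min !divr_gt0// mulr_gt0.
have t1 : t < 1 by rewrite !gt_min; apply/orP; right; apply/orP; left; lra.
have td : t < d by rewrite gt_min; apply/orP; left; lra.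
have te : t * c <= e / 2.
  have : t <= e / (2 * c) by rewrite !ge_min lexx !orbT.
  rewrite ler_pdivlMr ?mulr_gt0//; lra.
have := dD t; rewrite /ball_ /= sub0r normrN gtr0_norm// => /(_ td).
rewrite gt_eqF// => /(_ isT); rewrite ltr_norml => /andP[_ Dt].
have : t^-1 * (f (t *: h + x) - f x) <= f y - f x - mf / 2 * (1 - t) * H.
  rewrite mulrC ler_pdivrMr//.
  have t01 : 0 <= t <= 1 by rewrite !ltW.
  have := fconv y x t t01.
  have -> : t *: y + (1 - t) *: x = t *: h + x.
    by rewrite /h scalerBl scale1r scalerBr addrCA addrC.
  by rewrite -/h -/H; lra.
move: Dt; rewrite /= /GRing.scale /=.
have : mf / 2 * H * t <= e / 2.
  apply: le_trans te; rewrite mulrC ler_wpM2l ?(ltW t0)// /c.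
  by rewrite (le_trans (ler_norm _))// lerDr.
set q := t^-1 * _; lra.
Qed.

(** Apply the mean value theorem on [0, 1] to the difference [psi] between [f]
    along the segment and the quadratic upper model: its derivative at [c] is
    [<grad f (x + c h) - grad f x, h> - Lf c |h|^2], which is nonpositive by
    Cauchy-Schwarz and the Lipschitz bound. *)
Lemma descent_lemma Lf f x y : (forall z, differentiable f z) ->
  elipschitz Lf (grad f) ->
  f y <= f x + qdot 1%:M (grad f x) (y - x) + Lf / 2 * enorm (y - x) ^+ 2.
Proof.
move=> df fL; set h := y - x.
pose a := qdot 1%:M (grad f x) h; pose b := Lf / 2 * enorm h ^+ 2.
pose psi t : R := f (t *: h + x) - (t * a + t ^+ 2 * b).
pose dpsi t : R := qdot 1%:M (grad f (t *: h + x)) h - (a + 2 * t * b).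
have psi' (t : R) : is_derive t 1 psi (dpsi t).
  have ft := derive_line (df (t *: h + x)).
  have qt : is_derive t 1 (a \*: (@id R) + b \*: ((@id R) ^+ 2)) (a + 2 * t * b).
    apply: is_derive_eq; rewrite /GRing.scale /=; ring.
  have -> : psi = (fun s : R => f (s *: h + x)) - (a \*: (@id R) + b \*: ((@id R) ^+ 2)).
    apply/funext => s; rewrite /psi !fctE /=; congr (_ - _).
    by rewrite [a *: s]mulrC [b *: _]mulrC.
  exact: is_deriveB.
have [c c01] : exists2 c, c \in `]0, 1[ & psi 1 - psi 0 = dpsi c * (1 - 0).
  apply: MVT => //.
  apply: derivable_within_continuous => t _.
  by have [] := psi' t.
move: c01; rewrite in_itv /= => /andP[c0 c1].
rewrite subr0 mulr1 /psi scale1r scale0r add0r subrK => psiE.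
suff : dpsi c <= 0 by rewrite -/a -/b; lra.
rewrite /dpsi; have : c *: h + x - x = c *: h by rewrite addrK.
move: (c *: h + x) => z zx.
have : qdot 1%:M (grad f z - grad f x) h <= Lf * enorm (c *: h) * enorm h.
  apply: le_trans (qdot_cauchy_schwarz _ _ (posdefmx1 n)) _; rewrite -!enormE.
  by rewrite ler_wpM2r ?enorm_ge0//; apply: le_trans (fL _ _) _; rewrite zx.
rewrite enormZ (gtr0_norm c0) qdotDl qdotNl lerBlDr => h1.
rewrite subr_le0 addrC; apply: le_trans h1 _; rewrite lerD2r /b.
by rewrite le_eqVlt; apply/orP; left; apply/eqP; field.
Qed.

(** Compare with the value of [f] at [z], obtained from [y] by a gradient step
    of size [1 / Lf] for the function [f - <grad f x, _>]: the descent lemma bounds [f z]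
    from above, and convexity at [x] bounds it from below. Adding the inequality
    to its mirror image gives cocoercivity of the gradient. *)
Lemma convex_grad_coercive Lf f x y : 0 < Lf -> (forall z, differentiable f z) ->
  elipschitz Lf (grad f) -> strongly_convex 0 f ->
  f x + qdot 1%:M (grad f x) (y - x) + (2 * Lf)^-1 * enorm (grad f y - grad f x) ^+ 2
    <= f y.
Proof.
move=> L0 df fL fconv; set G := grad f y - grad f x.
pose z := y - Lf^-1 *: G.
have up := descent_lemma y z df fL.
have lo := strongly_convex_grad z (df x) fconv.
rewrite !mul0r addr0 in lo.
have zx : z - x = (y - x) - Lf^-1 *: G by rewrite /z addrAC.
have zy : z - y = - (Lf^-1 *: G) by rewrite /z addrAC subrr add0r.
rewrite zy in up; rewrite zx in lo; move: up lo; rewrite /G.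
move: (grad f x) (grad f y) (y - x) (f z) => gx gy d fz.
rewrite enormN enormZ exprMn real_normK ?num_real// sqr_enorm !qdot_bilin.
rewrite (dotC gy gx); set a := qdot _ gx gx; set b := qdot _ gy gy.
set e := qdot _ gx gy => up lo.
have eq1 : Lf / 2 * (Lf^-1 ^+ 2 * (b - e + (- e - - a))) =
           Lf^-1 * (b - e + (- e - - a)) / 2.
  by field; rewrite gt_eqF.
by rewrite eq1 in up; rewrite invfM; lra.
Qed.

Lemma strongly_convexW mf f : 0 <= mf -> strongly_convex mf f ->
  strongly_convex 0 f.
Proof.
move=> m0 fconv x y t t01; apply: le_trans (fconv x y t t01) _.
rewrite lerD2l lerN2 !mul0r !mulr_ge0 ?exprn_ge0 ?enorm_ge0 ?invr_ge0//; lra.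
Qed.

(** Expanding [|D - mu G|^2] with [D = x - y] and [G] the gradient difference,
    cocoercivity [|G|^2 <= Lf <G, D>] absorbs the quadratic term as long as
    [mu Lf < 2], and strong monotonicity [mf |D|^2 <= <G, D>] turns what is left
    into a decrease of [|D|^2]. *)
Lemma grad_step_contraction mf Lf mu f : 0 < mf -> 0 < mu < 2 / Lf ->
  (forall z, differentiable f z) -> elipschitz Lf (grad f) ->
  strongly_convex mf f ->
  exists2 r : R, 0 <= r < 1 & forall x y,
    enorm ((x - mu *: grad f x) - (y - mu *: grad f y)) <= r * enorm (x - y).
Proof.
move=> m0 /andP[mu0 muL] df fL fconv.
have L0 : 0 < Lf by have := lt_trans mu0 muL; rewrite pmulr_rgt0// invr_gt0.
have {}muL : 0 < 2 - mu * Lf by rewrite subr_gt0 -ltr_pdivlMr.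
pose q := 1 - mu * (2 - mu * Lf) * mf.
exists (Num.sqrt q) => [|x y].
  rewrite sqrtr_ge0 -[ltRHS]sqrtr1 ltr_sqrt// /q.
  by rewrite ltrBlDr ltrDl !mulr_gt0.
pose D := x - y; pose G := grad f x - grad f y.
have -> : x - mu *: grad f x - (y - mu *: grad f y) = D - mu *: G.
  by rewrite /D /G scalerBr !opprB addrACA [RHS]addrACA; congr (_ + _); rewrite addrC.
have coco : enorm G ^+ 2 <= Lf * qdot 1%:M G D.
  have f0 := strongly_convexW (ltW m0) fconv.
  have := convex_grad_coercive x y L0 df fL f0.
  have := convex_grad_coercive y x L0 df fL f0.
  rewrite /G /D; move: (grad f x) (grad f y) => gx gy.
  rewrite -[y - x]opprB -[gy - gx]opprB enormN; move: (x - y) => d.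
  rewrite !qdot_bilin invfM => h1 h2.
  rewrite mulrC -ler_pdivrMr// mulrC; lra.
have mono : mf * enorm D ^+ 2 <= qdot 1%:M G D.
  have := strongly_convex_grad x (df y) fconv.
  have := strongly_convex_grad y (df x) fconv.
  rewrite /G /D; move: (grad f x) (grad f y) => gx gy.
  rewrite -[y - x]opprB enormN; move: (x - y) => d.
  rewrite !qdot_bilin; lra.
rewrite -/D; move: D G coco mono => D G coco mono {fconv fL df}.
suff le2 : enorm (D - mu *: G) ^+ 2 <= enorm D ^+ 2 * q.
  rewrite -[leLHS]ger0_norm ?enorm_ge0// -sqrtr_sqr.
  apply: le_trans (ler_wsqrtr le2) _.
  by rewrite sqrtrM ?sqr_ge0// sqrtr_sqr ger0_norm ?enorm_ge0// mulrC.
rewrite sqr_enorm !qdot_bilin -!sqr_enorm [qdot _ D G]dotC /q.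
have h1 : mu * (mu * enorm G ^+ 2) <= mu * (mu * (Lf * qdot 1%:M G D)).
  by rewrite !ler_pM2l.
have h2 : (mu * (2 - mu * Lf)) * (mf * enorm D ^+ 2) <=
          (mu * (2 - mu * Lf)) * qdot 1%:M G D.
  by rewrite ler_pM2l// mulr_gt0.
lra.
Qed.

End SmoothStronglyConvex.

(** * The proximal map of a convex function *)

Section Prox.
Context {R : realType} {n : nat}.
Variable g : 'cV[R]_n -> \bar R.
Hypotheses (g_proper : proper_fun g) (g_convex : econvex g).
Implicit Types (u v x y p q : 'cV[R]_n).

Lemma proper_fin_num x (a : R) : (g x <= a%:E)%E -> exists2 r, g x = r%:E & r <= a.
Proof.
have := g_proper.1 x; case: (g x) => [r _|//|//].
by rewrite lee_fin; exists r.
Qed.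

(** Lower semicontinuity gives [g >= r0 - 1] on a ball of radius [d] around
    [x0]. A point outside is joined to [x0] by a segment crossing the ball, and
    convexity along it forces at most linear decrease. *)
Lemma econvex_conical_minorant : lower_semicontinuous g ->
  exists x0 (r0 K : R), [/\ g x0 = r0%:E, 0 < K &
    forall x, ((r0 - 1 - K * enorm (x - x0))%:E <= g x)%E].
Proof.
move=> g_lsc; have [x0 x0fin] := g_proper.2.
have [r0 gx0] : exists r0, g x0 = r0%:E.
  have := g_proper.1 x0; move: x0fin.
  by case: (g x0) => [r _ _|//|//]; exists r.
have [V /nbhs_enorm_ball[d d0 dV] Vg] : exists2 V, nbhs x0 V &
    forall y, V y -> ((r0 - 1)%:E < g y)%E.
  by apply: g_lsc; rewrite gx0 lte_fin; lra.
exists x0, r0, (2 / d); split; [by []|exact: divr_gt0|] => x.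
have [xd|xd] := ltP (enorm (x - x0)) d.
  apply: le_trans (ltW (Vg _ (dV _ xd))).
  by rewrite lee_fin gerBl mulr_ge0 ?enorm_ge0// divr_ge0// ltW.
set s := enorm (x - x0) in xd *; have s0 : 0 < s by exact: lt_le_trans xd.
(* With weight [t] on [x], the convex combination is at distance [d / 2] from
   [x0], inside the ball. *)
pose t := d / (2 * s); have t0 : 0 < t by rewrite divr_gt0// mulr_gt0.
have ts : t * s = d / 2 by rewrite /t; field; rewrite gt_eqF.
have t1 : t <= 1 by rewrite ler_pdivrMr ?mulr_gt0//; lra.
have : V (t *: x + (1 - t) *: x0).
  apply: dV; have -> : t *: x + (1 - t) *: x0 - x0 = t *: (x - x0).
    by rewrite scalerBl scale1r scalerBr addrA addrAC addrK.
  by rewrite enormZ gtr0_norm// -/s ts; lra.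
move=> /Vg /lt_le_trans; have t01 : 0 <= t <= 1 by rewrite ltW.
move=> /(_ _ (g_convex x x0 t01)); rewrite gx0.
have := g_proper.1 x; case: (g x) => [r _|_|//]; last by rewrite leey.
rewrite -!EFinM -EFinD lte_fin lee_fin => h.
have -> : 2 / d = t^-1 * s^-1.
  by rewrite /t; field; rewrite !gt_eqF.
rewrite mulfVK ?gt_eqF//.
have tV : t * t^-1 = 1 by rewrite divff// gt_eqF.
rewrite -(ler_pM2l t0) !mulrBr tV; lra.
Qed.

Variable mu : R.
Hypothesis mu0 : 0 < mu.
Let c := (2 * mu)^-1.
Let phi v x := (g x + (c * enorm (x - v) ^+ 2)%:E)%E.

Let c0 : 0 < c. Proof. by rewrite invr_gt0 mulr_gt0. Qed.

Lemma enorm_convex_comb v x y (t : R) :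
  enorm (t *: x + (1 - t) *: y - v) ^+ 2 =
  t * enorm (x - v) ^+ 2 + (1 - t) * enorm (y - v) ^+ 2
  - t * (1 - t) * enorm (x - y) ^+ 2.
Proof.
have -> : t *: x + (1 - t) *: y - v = t *: (x - v) + (1 - t) *: (y - v).
  rewrite !scalerBr addrACA -opprD -scalerDl.
  by rewrite [t + _]addrC subrK scale1r.
have -> : x - y = (x - v) - (y - v) by rewrite opprB addrA subrK.
move: (x - v) (y - v) => a b; rewrite !sqr_enorm !qdot_bilin (dotC b a); ring.
Qed.

(** The quadratic term provides the strong convexity. Values are compared
    with real bounds [a] and [b], which confines the statement to the domain of
    [g]. *)
Lemma prox_objective_strongly_convex v x y (t a b : R) : 0 <= t <= 1 ->
  (phi v x <= a%:E)%E -> (phi v y <= b%:E)%E ->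
  (phi v (t *: x + (1 - t) *: y) <=
     (t * a + (1 - t) * b - c * t * (1 - t) * enorm (x - y) ^+ 2)%:E)%E.
Proof.
move=> t01; rewrite /phi -!leeBrDr// -!EFinB.
move=> /proper_fin_num[r gx ra] /proper_fin_num[s gy sb].
apply: le_trans (g_convex x y t01) _; rewrite gx gy -!EFinM -EFinD lee_fin.
rewrite enorm_convex_comb.
move: t01 => /andP[t0 t1].
have h1 : t * r <= t * (a - c * enorm (x - v) ^+ 2) by rewrite ler_wpM2l.
have h2 : (1 - t) * s <= (1 - t) * (b - c * enorm (y - v) ^+ 2).
  by rewrite ler_wpM2l// subr_ge0.
lra.
Qed.

(** The linear decrease of the minorant of [g] is dominated by the quadratic
    term; [B] is the bound obtained by completing the square. *)
Lemma prox_objective_inf v : lower_semicontinuous g ->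
  exists I : R, (forall x, (I%:E <= phi v x)%E) /\
    forall e, 0 < e -> exists x, (phi v x <= (I + e)%:E)%E.
Proof.
move=> /econvex_conical_minorant[x0 [r0 [K [gx0 K0 Kg]]]].
pose A : set R := [set s | exists x, phi v x = s%:E].
pose B := r0 - 1 - K * enorm (v - x0) - K ^+ 2 / (4 * c).
have phi_ge x : (B%:E <= phi v x)%E.
  rewrite -leeBlDr// -EFinB; apply: le_trans (Kg x).
  rewrite lee_fin /B.
  have h : K * enorm (x - x0) <= K * (enorm (x - v) + enorm (v - x0)).
    rewrite ler_pM2l//; apply: le_trans (ler_enormD _ _).
    by rewrite addrA subrK.
  have : 0 <= c * (enorm (x - v) - K / (2 * c)) ^+ 2.
    by rewrite mulr_ge0 ?sqr_ge0// ltW.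
  have -> : c * (enorm (x - v) - K / (2 * c)) ^+ 2 =
     c * enorm (x - v) ^+ 2 - K * enorm (x - v) + K ^+ 2 / (4 * c).
    by field; rewrite gt_eqF.
  lra.
have A_inf : has_inf A.
  split.
    by exists (r0 + c * enorm (x0 - v) ^+ 2); exists x0; rewrite /phi gx0.
  by exists B => s [x phix]; have := phi_ge x; rewrite phix lee_fin.
have finE x : (phi v x = +oo%E) \/ exists s, phi v x = s%:E.
  by have := phi_ge x; case: (phi v x) => [s _|_|//]; [right; exists s|left].
exists (inf A); split=> [x|e e0].
  have [->|[s phix]] := finE x; first by rewrite leey.
  by rewrite phix lee_fin; apply: ge_inf; [exact: A_inf.2|exists x].
have [s [x phix] sI] := inf_adherent e0 A_inf.
by exists x; rewrite phix lee_fin ltW.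
Qed.

(** Near-minimizers have near-minimizing midpoints, so strong convexity bounds
    their distance: a gap of [c e^2 / 4] keeps them within [e]. Their limit is a
    minimizer by lower semicontinuity. *)
Lemma prox_argmin_nonempty v : lower_semicontinuous g ->
  exists p, prox_argmin mu g v p.
Proof.
move=> g_lsc; have [I [I_le I_inf]] := prox_objective_inf v g_lsc.
pose P e x := (phi v x <= (I + c * e ^+ 2 / 4)%:E)%E.
have [|||l Pl] := @approx_limit R n P.
- by move=> e e0; apply: I_inf; rewrite divr_gt0// mulr_gt0// exprn_gt0.
- move=> e e' x e'0 ee' /le_trans; apply; rewrite lee_fin lerD2l.
  rewrite ler_pM2r// ler_pM2l// ler_sqr// nnegrE ltW//.
  exact: lt_le_trans ee'.
- move=> e x y e0 Px Py.
  have t01 : 0 <= (1 / 2 : R) <= 1 by apply/andP; split; lra.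
  have := le_trans (I_le _) (prox_objective_strongly_convex t01 Px Py).
  rewrite lee_fin => h.
  rewrite -ler_sqr ?nnegrE ?enorm_ge0 ?(ltW e0)// -(ler_pM2l c0); lra.
exists l => y; apply: le_trans (I_le y); rewrite -leeBrDr// -EFinB.
(* It is enough to test real minorants of [g l], as lower semicontinuity
   does; this also excludes [g l = +oo]. *)
suff lsc_le (a : R) : (a%:E < g l)%E -> a <= I - c * enorm (l - v) ^+ 2.
  move: lsc_le; case: (g l) => [r h|h|_]; last by rewrite leNye.
    rewrite lee_fin leNgt; apply/negP => /midf_lt[]; set a := _ / 2 => a1 a2.
    by have := h a; rewrite lte_fin a2 leNgt a1 => /(_ isT).
  have := h (I - c * enorm (l - v) ^+ 2 + 1) (ltry _).
  by rewrite gerDl ler10.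
move=> /g_lsc[V /nbhs_enorm_ball[d d0 dV] Vg].
apply/ler_addgt0Pr => z z0.
(* [k] bounds the rate at which the quadratic term and the gap vary with [e]. *)
pose k := c * (1 + 2 * enorm (l - v)).
have k0 : 0 < k by rewrite mulr_gt0// ltr_pwDl// mulr_ge0// enorm_ge0.
pose e := Num.min (d / 2) (Num.min 1 (z / k)).
have e0 : 0 < e by rewrite !lt_min ltr01 !divr_gt0.
have ed : e < d by rewrite gt_min; apply/orP; left; lra.
have e1 : e <= 1 by rewrite !ge_min lexx !orbT.
have ez : e * k <= z by rewrite -ler_pdivlMr// !ge_min lexx !orbT.
have [x Px xl] := Pl e e0.
have /Vg ax := dV x (le_lt_trans xl ed).
move: Px; rewrite /P /phi -leeBrDr// -EFinB => /(lt_le_trans ax).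
rewrite lte_fin => {}ax.
have xv : enorm (l - v) ^+ 2 - 2 * e * enorm (l - v) <= enorm (x - v) ^+ 2.
  have -> : x - v = (l - v) - (l - x) by rewrite opprB [RHS]addrC addrA subrK.
  have : qdot 1%:M (l - x) (l - v) <= e * enorm (l - v).
    apply: le_trans (qdot_cauchy_schwarz _ _ (posdefmx1 n)) _; rewrite -!enormE.
    by rewrite ler_wpM2r ?enorm_ge0// -[l - x]opprB enormN.
  move: (l - x) (l - v) => s w sw.
  rewrite [leRHS]sqr_enorm !qdot_bilin (dotC w s) -!sqr_enorm.
  have := sqr_ge0 (enorm s); lra.
have e2 : e ^+ 2 <= e by rewrite expr2 ler_piMl// ltW.
have ce2 : c * e ^+ 2 <= c * e by rewrite ler_pM2l.
have ce0 : 0 < c * e by rewrite mulr_gt0.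
have := ler_wpM2l (ltW c0) xv; rewrite /k in ez; lra.
Qed.

End Prox.

Lemma proxP (R : realType) n (mu : R) (g : 'cV[R]_n -> \bar R) v :
  0 < mu -> proper_fun g -> lower_semicontinuous g -> econvex g ->
  prox_argmin mu g v (prox mu g v).
Proof.
move=> mu0 g_proper g_lsc g_convex.
apply: (@xgetPex _ 0 (prox_argmin mu g v)); exact: prox_argmin_nonempty.
Qed.

(** Quadratic growth of the objective at its minimizer: compare with the value
    at [t q + (1 - t) p] and let [t] tend to 0. *)
Lemma prox_argmin_strong (R : realType) n (mu : R) (g : 'cV[R]_n -> \bar R)
    v p q (a b : R) :
  0 < mu -> proper_fun g -> econvex g -> prox_argmin mu g v p ->
  g p = a%:E -> g q = b%:E ->
  a + (2 * mu)^-1 * (enorm (p - v) ^+ 2 + enorm (q - p) ^+ 2)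
    <= b + (2 * mu)^-1 * enorm (q - v) ^+ 2.
Proof.
move=> mu0 g_proper g_convex pmin gp gq; set c := (2 * mu)^-1.
have c0 : 0 < c by rewrite invr_gt0 mulr_gt0.
apply/ler_addgt0Pr => e e0; set D := enorm (q - p) ^+ 2.
have D0 : 0 <= D by exact: sqr_ge0.
have k0 : 0 < c * D + 1 by rewrite ltr_wpDl// mulr_ge0// ltW.
pose t := Num.min (1 / 2) (e / (c * D + 1)).
have t0 : 0 < t by rewrite lt_min !divr_gt0.
have t1 : t <= 1 / 2 by rewrite ge_min lexx.
have te : t * (c * D + 1) <= e by rewrite -ler_pdivlMr// ge_min lexx orbT.
have t01 : 0 <= t <= 1 by apply/andP; split; lra.
have := le_trans (pmin (t *: q + (1 - t) *: p))
  (prox_objective_strongly_convex g_proper g_convex t01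
     (_ : (_ <= (b + c * enorm (q - v) ^+ 2)%:E)%E)
     (_ : (_ <= (a + c * enorm (p - v) ^+ 2)%:E)%E)).
rewrite gp gq -!EFinD => /(_ (lexx _) (lexx _)); rewrite lee_fin -/c -/D => h.
have : t * (a + c * (enorm (p - v) ^+ 2) + c * (1 - t) * D) <=
       t * (b + c * enorm (q - v) ^+ 2) by lra.
rewrite ler_pM2l//; lra.
Qed.

(** Add the growth inequalities of both objectives at each other's minimizer:
    the values of [g] cancel and leave [|p - q|^2 <= <p - q, u - v>]. *)
Lemma prox_nonexpansive (R : realType) n (mu : R) (g : 'cV[R]_n -> \bar R) u v :
  0 < mu -> proper_fun g -> lower_semicontinuous g -> econvex g ->
  enorm (prox mu g u - prox mu g v) <= enorm (u - v).
Proof.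
move=> mu0 g_proper g_lsc g_convex.
have c0 : 0 < (2 * mu)^-1 by rewrite invr_gt0 mulr_gt0.
have fin w : exists a, g (prox mu g w) = a%:E.
  have [x gx] := g_proper.2.
  have := proxP w mu0 g_proper g_lsc g_convex x.
  have := g_proper.1 (prox mu g w).
  case: (g (prox mu g w)) => [a _ _|_ /=|//]; first by exists a.
  rewrite leye_eq; move: gx; case: (g x) => //=.
have pmin := proxP u mu0 g_proper g_lsc g_convex.
have qmin := proxP v mu0 g_proper g_lsc g_convex.
have [a gp] := fin u; have [b gq] := fin v; move: gp gq pmin qmin.
move: (prox mu g u) (prox mu g v) => p q gp gq pmin qmin.
have h1 := prox_argmin_strong mu0 g_proper g_convex pmin gp gq.
have h2 := prox_argmin_strong mu0 g_proper g_convex qmin gq gp.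
rewrite -ler_sqr ?nnegrE ?enorm_ge0//.
have : enorm (p - u) ^+ 2 + enorm (q - v) ^+ 2 + 2 * enorm (p - q) ^+ 2 <=
       enorm (q - u) ^+ 2 + enorm (p - v) ^+ 2.
  rewrite -(ler_pM2l c0); move: h1; rewrite -[q - p]opprB enormN; lra.
have := sqr_ge0 (enorm ((p - q) - (u - v))).
rewrite !sqr_enorm !qdot_bilin.
rewrite !(dotC q p) !(dotC u p) !(dotC v p) !(dotC u q) !(dotC v q) !(dotC v u).
lra.
Qed.

(** * Contractions on the state space *)

Section ProductContraction.
Context {R : realType} {n m : nat}.
Local Notation state := ('cV[R]_n * 'cV[R]_m)%type.

Lemma sqr_enorm_col_mx (x : 'cV[R]_n) (v : 'cV[R]_m) :
  enorm (col_mx x v) ^+ 2 = enorm x ^+ 2 + enorm v ^+ 2.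
Proof. by rewrite !sqr_enorm !qdot1E tr_col_mx mul_row_col mxE. Qed.

Lemma enorm_col_mxl (x : 'cV[R]_n) (v : 'cV[R]_m) : enorm x <= enorm (col_mx x v).
Proof.
by rewrite -ler_sqr ?nnegrE ?enorm_ge0// sqr_enorm_col_mx lerDl sqr_ge0.
Qed.

Lemma enorm_col_mxr (x : 'cV[R]_n) (v : 'cV[R]_m) : enorm v <= enorm (col_mx x v).
Proof.
by rewrite -ler_sqr ?nnegrE ?enorm_ge0// sqr_enorm_col_mx lerDr sqr_ge0.
Qed.

Lemma enorm_col_mx_le (x : 'cV[R]_n) (v : 'cV[R]_m) :
  enorm (col_mx x v) <= enorm x + enorm v.
Proof.
rewrite -ler_sqr ?nnegrE ?addr_ge0 ?enorm_ge0// sqr_enorm_col_mx sqrrD.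
by rewrite lerD2r lerDl mulrn_wge0// mulr_ge0// enorm_ge0.
Qed.

(** Stacking the two components into one column turns [pnorm] into the
    Euclidean norm, so the fixed point theorem applies; the rest is the geometric
    decay of [W] along trajectories. *)
Lemma contraction_globally_exp_stable (W : state -> R) (F : state -> state)
    (a b r : R) :
  0 < a -> 0 < b -> 0 < r < 1 ->
  (forall z z', W (z + z') <= W z + W z') -> (forall z, W (- z) = W z) ->
  (forall z, pnorm z <= a * W z) -> (forall z, W z <= b * pnorm z) ->
  (forall z z', W (F z - F z') <= r * W (z - z')) ->
  exists zs, [/\ equilibrium F zs,
    forall z, equilibrium F z -> z = zs & globally_exp_stable F zs].
Proof.
move=> a0 b0 r01 WD WN aW Wb FW; have /andP[r0 r1] := r01.
pose unjoin (w : 'cV[R]_(n + m)) : state := (usubmx w, dsubmx w).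
pose join (z : state) := col_mx z.1 z.2.
have joinK z : unjoin (join z) = z.
  by case: z => x v; rewrite /unjoin /join col_mxKu col_mxKd.
have unjoinN w : unjoin (- w) = - unjoin w by rewrite /unjoin !linearN.
have unjoinD w w' : unjoin (w + w') = unjoin w + unjoin w' by rewrite /unjoin !linearD.
have norm_unjoin w : pnorm (unjoin w) = enorm w by rewrite /pnorm vsubmxK.
have [|||||l Fl] :=
  @banach_fixed_point R _ (W \o unjoin) (join \o F \o unjoin) a b r a0 b0 r01.
- by move=> w w' /=; rewrite unjoinD.
- by move=> w /=; rewrite unjoinN.
- by move=> w /=; rewrite -norm_unjoin.
- by move=> w /=; rewrite -norm_unjoin.
- by move=> w w' /=; rewrite !unjoinD !unjoinN !joinK.
have zsF : F (unjoin l) = unjoin l by rewrite -[in RHS]Fl /= joinK.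
exists (unjoin l); split=> [//|z zF|].
  have : (1 - r) * W (z - unjoin l) <= 0.
    by have := FW z (unjoin l); rewrite zF zsF; lra.
  rewrite pmulr_rle0 ?subr_gt0// => W0.
  have /enorm_eq0 : pnorm (z - unjoin l) = 0.
    apply/le_anti; rewrite enorm_ge0 andbT (le_trans (aW _))//.
    by rewrite pmulr_rle0.
  rewrite -col_mx0 => /eq_col_mx[/= zl1 zl2].
  apply/eqP; rewrite -subr_eq0; apply/eqP.
  by rewrite [LHS]surjective_pairing /= zl1 zl2.
exists (a * b), r; split=> [|//|z0 k]; first exact: mulr_gt0.
have Witer : W (iter k F z0 - unjoin l) <= r ^+ k * W (z0 - unjoin l).
  elim: k => [|k IH]; first by rewrite expr0 mul1r.
  rewrite iterS -[in X in W (_ - X)]zsF; apply: le_trans (FW _ _) _.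
  by rewrite exprS -mulrA ler_pM2l.
apply: le_trans (aW _) _; rewrite -!mulrA ler_pM2l//.
apply: le_trans Witer _; rewrite mulrCA ler_pM2l ?exprn_gt0//.
Qed.

End ProductContraction.

Section ConstraintProjection.
Context {R : realType} {n m : nat}.
Variable C : 'M[R]_(m, n).
Hypothesis C_full_rank : \rank C = m.
Let Cpinv := C^T *m invmx (C *m C^T).

(** If [v C C^T = 0] then [|v C|^2 = v C C^T v^T = 0], and [C] has independent
    rows. *)
Lemma gram_unitmx : C *m C^T \in unitmx.
Proof.
rewrite -row_free_unit; apply/inj_row_free => v vCC.
have C_free : row_free C by rewrite /row_free C_full_rank.
apply/eqP; rewrite -(mulmx_free_eq0 v C_free) -trmx_eq0; apply/eqP/enorm_eq0.
apply/eqP; rewrite -sqrf_eq0 sqr_enorm qdot1E trmxK trmx_mul !mulmxA.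
by rewrite -[v *m C *m _]mulmxA vCC mul0mx mxE.
Qed.

Lemma mulmx_pinv (w : 'cV[R]_m) : C *m (Cpinv *m w) = w.
Proof. by rewrite /Cpinv !mulmxA mulmxV ?gram_unitmx// mul1mx. Qed.

(** The two parts of [x] are orthogonal: one lies in the kernel of [C], the
    other in the range of [C^T]. *)
Lemma kernel_projection_nonexpansive (x : 'cV[R]_n) :
  enorm (x - Cpinv *m (C *m x)) <= enorm x.
Proof.
set y := x - _; have Cy : C *m y = 0 by rewrite mulmxBr mulmx_pinv subrr.
have xE : x = y + Cpinv *m (C *m x) by rewrite subrK.
set w := invmx (C *m C^T) *m (C *m x).
have orth : qdot 1%:M y (C^T *m w) = 0.
  by rewrite dot_mulr trmxK Cy qdot0l.
rewrite -ler_sqr ?nnegrE ?enorm_ge0// [in leRHS]xE /Cpinv -mulmxA -/w.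
move: (y) orth => {Cy xE}y orth.
rewrite [leRHS]sqr_enorm !qdot_bilin (dotC (C^T *m w) y) orth.
by rewrite addr0 add0r -!sqr_enorm lerDl sqr_ge0.
Qed.

End ConstraintProjection.

Lemma prox_grad_contraction (R : realType) n (f : 'cV[R]_n -> R) (mf Lf mu : R)
    (g : 'cV[R]_n -> \bar R) :
  0 < mf -> 0 < mu < 2 / Lf -> (forall z, differentiable f z) ->
  elipschitz Lf (grad f) -> strongly_convex mf f ->
  proper_fun g -> lower_semicontinuous g -> econvex g ->
  exists2 r : R, 0 <= r < 1 & elipschitz r (prox_grad mu f g).
Proof.
move=> mf0 mu01 df fL fconv g_proper g_lsc g_convex.
have [r r01 stepr] := grad_step_contraction mf0 mu01 df fL fconv.
exists r => // x y; apply: le_trans (stepr x y).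
by apply: prox_nonexpansive; case/andP: mu01.
Qed.

Lemma update_subE (R : realType) n m (mu : R) (f : 'cV[R]_n -> R)
    (g : 'cV[R]_n -> \bar R) (C : 'M[R]_(m, n)) d (K L : 'M[R]_m) z z' :
  let Cpinv := C^T *m invmx (C *m C^T) in
  let p := prox_grad mu f g z.1 - prox_grad mu f g z'.1 in
  update mu f g C d K L z - update mu f g C d K L z' =
  ((p - Cpinv *m (C *m p)) + Cpinv *m (z.2 - z'.2),
   K *m (z.2 - z'.2) + L *m (C *m (z.1 - z'.1))).
Proof.
case: z z' => [x v] [x' v'] Cpinv p /=; congr pair; last first.
  by rewrite /= opprD addrACA -!mulmxBr opprD addrACA subrr addr0 -mulmxBr.
rewrite {}/p /=.
move: (prox_grad mu f g x) (prox_grad mu f g x') => y y'.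
rewrite -/Cpinv.
move: Cpinv => G.
rewrite !mulmxBr !mulmxDr.
move: (G *m (C *m y)) (G *m (C *m y')) (G *m d) => a a' b.
by move: (G *m v) (G *m v') => w w'; apply/colP => i; rewrite !mxE; ring.
Qed.

Theorem theorem1 (R : realType) (n m : nat)
  (f : 'cV[R]_n -> R) (mf Lf : R)
  (f_C1 : continuously_differentiable f)
  (mf_gt0 : 0 < mf) (f_sconvex : strongly_convex mf f)
  (f_smooth : elipschitz Lf (grad f))
  (g : 'cV[R]_n -> \bar R)
  (g_proper : proper_fun g) (g_lsc : lower_semicontinuous g)
  (g_convex : econvex g)
  (C : 'M[R]_(m, n)) (C_full_rank : \rank C = m) (d : 'cV[R]_m)
  (K L : 'M[R]_m)
  (N_stable : exists (Q : 'M[R]_(m + m)) (re : R),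
     let N := block_mx 0 1%:M L K in
     [/\ posdefmx Q, 0 < re < 1 &
         negdefmx (N *m Q *m N^T - (1 - re) *: Q)]) :
  forall mu : R, 0 < mu < 2 / Lf ->
    exists zs : 'cV[R]_n * 'cV[R]_m,
      [/\ equilibrium (update mu f g C d K L) zs,
          forall z, equilibrium (update mu f g C d K L) z -> z = zs &
          globally_exp_stable (update mu f g C d K L) zs].
Proof.
move=> mu mu01; have [Q [re [Qpos re01 Nneg]]] := N_stable.
have [s s01 Ns] := lyapunov_contraction Qpos re01 Nneg.
set N := block_mx _ _ _ _ in Ns; set S := invmx Q in Ns.
have Spos : posdefmx S := posdefmx_inv Qpos.
have [rho rho01 Pi_rho] := prox_grad_contraction mf_gt0 mu01 f_C1.1 f_smooth
  f_sconvex g_proper g_lsc g_convex.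
have [k k0 Cpinv_le] := mulmx_bounded (C^T *m invmx (C *m C^T)).
have [cS cS0 le_S] := qnorm_coercive Spos.
have [cU cU0 S_le] := qnorm_bounded Spos.
pose M := block_mx C 0 0 1%:M : 'M[R]_(m + m, n + m).
have [cM cM0 M_le] := mulmx_bounded M.
have /andP[s0 s1] := s01; have /andP[rho0 rho1] := rho01.
pose eta (z : 'cV[R]_n * 'cV[R]_m) := col_mx (C *m z.1) z.2.
have etaE z : eta z = M *m col_mx z.1 z.2.
  by rewrite mul_block_col !mul0mx addr0 add0r mul1mx.
have s'0 : 0 < 1 - s by rewrite subr_gt0.
(* The input of [v] into [x] costs [k cS |eta|_S]; this [beta] makes it half of
   the decrease [beta (1 - s) |eta|_S] of the second term. *)
pose beta := 2 * (k * cS) / (1 - s).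
have beta0 : 0 < beta by rewrite divr_gt0// !mulr_gt0.
have betaE : beta * (1 - s) = 2 * (k * cS) by rewrite divfK// gt_eqF.
pose W z := enorm z.1 + beta * qnorm S (eta z).
have etaD z z' : eta (z + z') = eta z + eta z'.
  by rewrite /eta /= mulmxDr add_col_mx.
have etaN z : eta (- z) = - eta z by rewrite /eta /= mulmxN opp_col_mx.
pose r := Num.max rho ((1 + s) / 2).
have rhor : rho <= r by rewrite le_max lexx.
have sr : (1 + s) / 2 <= r by rewrite le_max lexx orbT.
have r1 : r < 1 by rewrite gt_max rho1 /=; lra.
have r0 : 0 < r by apply: lt_le_trans sr; lra.
apply: (@contraction_globally_exp_stable R n m W _ (1 + cS / beta)
  (1 + beta * (cU * cM)) r).
- by rewrite addr_gt0// divr_gt0.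
- by rewrite addr_gt0// (mulr_gt0 beta0)// mulr_gt0.
- by rewrite r0 r1.
- move=> z z'; rewrite /W etaD addrACA -mulrDr lerD ?ler_enormD//.
  by rewrite ler_pM2l//; exact: ler_qnormD.
- by move=> z; rewrite /W etaN qnormN enormN.
- move=> z; apply: le_trans (enorm_col_mx_le _ _) _.
  have : enorm z.2 <= cS * qnorm S (eta z).
    exact: le_trans (enorm_col_mxr _ _) (le_S _).
  have -> : cS * qnorm S (eta z) = cS / beta * (beta * qnorm S (eta z)).
    by rewrite mulrA divfK// gt_eqF.
  have : 0 <= cS / beta * enorm z.1 by rewrite mulr_ge0 ?enorm_ge0// divr_ge0// ltW.
  have : 0 <= beta * qnorm S (eta z) by rewrite mulr_ge0 ?qnorm_ge0// ltW.
  rewrite /W; lra.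
- move=> z; rewrite mulrDl mul1r lerD ?enorm_col_mxl//.
  rewrite -mulrA ler_pM2l// (le_trans (S_le _))// -mulrA ler_pM2l//.
  by rewrite etaE.
move=> z z'; pose e := eta (z - z').
(* The linear dynamics: the new residual is [v], so [eta] is mapped by [N]. *)
have etaF : eta (update mu f g C d K L z - update mu f g C d K L z') = N *m e.
  rewrite update_subE /e /eta mul_block_col mul0mx add0r mul1mx /=.
  by rewrite mulmxDr mulmxBr !mulmx_pinv// subrr add0r [K *m _ + _]addrC.
rewrite /W etaF.
have h1 : enorm (update mu f g C d K L z - update mu f g C d K L z').1
    <= rho * enorm (z - z').1 + k * (cS * qnorm S e).
  rewrite update_subE /=; apply: le_trans (ler_enormD _ _) _; apply: lerD.
    apply: le_trans (kernel_projection_nonexpansive C_full_rank _) _.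
    exact: Pi_rho.
  apply: le_trans (Cpinv_le _) _; rewrite ler_pM2l//.
  exact: le_trans (enorm_col_mxr _ _) (le_S _).
have h2 : beta * qnorm S (N *m e) <= beta * (s * qnorm S e).
  by rewrite ler_pM2l.
have h3 : rho * enorm (z - z').1 <= r * enorm (z - z').1.
  by rewrite ler_wpM2r ?enorm_ge0.
have h4 : (1 + s) / 2 * (beta * qnorm S e) <= r * (beta * qnorm S e).
  by rewrite ler_wpM2r// mulr_ge0 ?qnorm_ge0// ltW.
have h5 : beta * (1 - s) * qnorm S e = 2 * (k * cS) * qnorm S e by rewrite betaE.
rewrite -/e; lra.
Qed.
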